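(* Let $\mathbf{k}$ be an algebraically closed field of characteristic zero, $S=\mathbf{k}[x_0,\dots,x_n]$ and $\Gamma=\mathbf{k}[y_0,\dots,y_n]$, where $S$ acts on $\Gamma$ by derivation $\circ$. Let $H\in \Gamma\setminus\{0\}$ be a homogeneous polynomial, and let $\underline{d}=(d_0,\dots,d_n)$ be integers with $2\le d_0\le\dots\le d_n$. Then the ideal $\operatorname{Ann}\langle H\rangle\subset S$ is a complete intersection of type $\underline{d}$ if and only if there exist homogeneous forms $\underline{f}=\{f_0,\dots,f_n\}\subset S$ such that $\deg(f_i)=d_i$ for $i=0,\dots,n$, and (i) $\operatorname{Res}(\underline{f})\neq 0$, (ii) $\underline{f}\circ H=0$, that is, $f_i\circ H=0$ for all $i=0,\dots,n$, and (iii) $\det(\operatorname{Jac}(\underline{f}))\circ H\neq 0$. Moreover, if these equivalent conditions hold (with $\underline{f}$ satisfying (i), (ii), (iii)), then $\operatorname{Ann}\langle H\rangle=(f_0,\dots,f_n)$ and $\deg(H)=\sum_{i=0}^n d_i-(n+1)$.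
   Context: The polynomial rings $S=\mathbf{k}[x_0,\dots,x_n]$ and $\Gamma=\mathbf{k}[y_0,\dots,y_n]$ are graded in the standard way. $\Gamma$ is an $S$-module by derivation: for $f\in S$ and $g\in\Gamma$, $f\circ g=f(\partial_{y_0},\dots,\partial_{y_n})(g)$, where $\partial_{y_i}$ is the partial derivative with respect to $y_i$. For $H\in\Gamma$, $\langle H\rangle$ is the sub-$S$-module of $\Gamma$ generated by $H$, and $\operatorname{Ann}\langle H\rangle=\{g\in S: g\circ H=0\}$. A homogeneous ideal $I\subset S$ is a complete intersection of type $(d_0,\dots,d_n)$, with $2\le d_0\le\dots\le d_n$, if there exists a homogeneous regular sequence $f_0,\dots,f_n$ minimally generating $I$ with $\deg(f_i)=d_i$ for $i=0,\dots,n$. $\operatorname{Res}(\underline{f})$ is the (projective) resultant of the $n+1$ forms $f_0,\dots,f_n$ of degrees $d_0,\dots,d_n$: it is the irreducible polynomial in the coefficients of the forms that defines the hypersurface of tuples having a common zero in $\mathbb{P}^n_{\mathbf{k}}$. Thus $\operatorname{Res}(\underline{f})\ne0$ if and only if $f_0,\dots,f_n$ have no common zero in $\mathbb{P}^n_{\mathbf{k}}$. $\operatorname{Jac}(\underline{f})$ is the $(n+1)\times(n+1)$ Jacobian matrix $(\partial f_i/\partial x_j)_{0\le i,j\le n}$. *)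

(* Defs.v *)
From mathcomp Require Export all_boot all_order all_algebra.
From mathcomp Require Export mpoly.

Set Implicit Arguments.
Unset Strict Implicit.
Unset Printing Implicit Defensive.

Import GRing.Theory.
Local Open Scope ring_scope.

(* Both polynomial rings S and Gamma are rendered as {mpoly k[n.+1]}; the     *)
(* variable x_i (resp. y_i) is 'X_i.                                          *)

(* f o g = f(d/dy_0, ..., d/dy_n)(g) *)
Definition apolar (k : fieldType) (n : nat) (f g : {mpoly k[n]}) :
    {mpoly k[n]} :=
  \sum_(m <- msupp f) f@_m *: g^`M[m].

Definition Ann (k : fieldType) (n : nat) (H : {mpoly k[n]}) :
    {mpoly k[n]} -> Prop :=
  fun g => apolar g H = 0.

Definition Jac (k : fieldType) (n : nat) (f : 'I_n -> {mpoly k[n]}) :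
    'M[{mpoly k[n]}]_n :=
  \matrix_(i < n, j < n) (f i)^`M(j).

Definition form_of_degree (k : fieldType) (n e : nat) (p : {mpoly k[n]}) : Prop :=
  p != 0 /\ p \is e.-homog.

Section Ideals.
Variable A : comNzRingType.

(* Membership in the ideal generated by the f i such that P i. *)
Definition in_ideal (r : nat) (f : 'I_r -> A) (P : pred 'I_r) (g : A) : Prop :=
  exists c : 'I_r -> A, g = \sum_(i < r | P i) c i * f i.

Definition regular_sequence (r : nat) (f : 'I_r -> A) : Prop :=
  ~ in_ideal f predT 1 /\
  forall (i : 'I_r) (g : A),
    in_ideal f (fun j => (j < i)%N) (g * f i) ->
    in_ideal f (fun j => (j < i)%N) g.

Definition generates (r : nat) (f : 'I_r -> A) (P : pred 'I_r)
    (I : A -> Prop) : Prop :=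
  forall g, I g <-> in_ideal f P g.

Definition minimally_generates (r : nat) (f : 'I_r -> A)
    (I : A -> Prop) : Prop :=
  generates f predT I /\
  forall J : {set 'I_r}, generates f (mem J) I -> J = setT.

End Ideals.

(* That I is a homogeneous ideal is a consequence: it is generated by forms. *)
Definition complete_intersection (k : fieldType) (n : nat)
    (d : 'I_n.+1 -> nat) (I : {mpoly k[n.+1]} -> Prop) : Prop :=
  exists f : 'I_n.+1 -> {mpoly k[n.+1]},
    [/\ forall i, form_of_degree (d i) (f i),
        regular_sequence f
      & minimally_generates f I].

(* Indices (i, m) of the coefficients of a tuple of n forms of degrees d i in *)
(* n variables: m is a monomial of degree d i.                                *)
Definition coef_index (n : nat) (d : 'I_n -> nat) : finType :=
  {i : 'I_n & {m : 'X_{1..n < (d i).+1} | mdeg m == d i}}.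

Definition coefs (k : fieldType) (n : nat) (d : 'I_n -> nat)
    (f : 'I_n -> {mpoly k[n]}) (j : 'I_#|coef_index d|) : k :=
  let c : coef_index d := enum_val j in (f (tag c))@_(val (val (tagged c))).
Arguments coefs {k n} d f j.

Definition common_projective_zero (k : fieldType) (n : nat)
    (f : 'I_n -> {mpoly k[n]}) : Prop :=
  exists v : 'I_n -> k,
    (exists i, v i != 0) /\ (forall i, (f i).@[v] = 0).

Definition irreducible_elt (A : idomainType) (p : A) : Prop :=
  [/\ p != 0, p \isn't a GRing.unit
    & forall a b : A, p = a * b -> a \is a GRing.unit \/ b \is a GRing.unit].

(* Over an algebraically closed field these conditions determine R up to a    *)
(* nonzero scalar. Here f ranges over all tuples in the coefficient space, so *)
(* some f i may be zero.                                                      *)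
Definition is_resultant (k : fieldType) (n : nat) (d : 'I_n -> nat)
    (R : {mpoly k[#|coef_index d|]}) : Prop :=
  irreducible_elt R /\
  forall f : 'I_n -> {mpoly k[n]}, (forall i, f i \is (d i).-homog) ->
    (R.@[coefs d f] = 0 <-> common_projective_zero f).

(* Main.v *)
(* Write f = M x, where M is Jac f with rows divided by the degrees (Euler's  *)
(* formula), so that det M and det (Jac f) are proportional.                  *)
(* - Suppose f o H = 0 and det M o H != 0. Write f_i(x) - f_i(y) as           *)
(*   \sum_j theta_ij (x_j - y_j) with theta_ij(x, 0) = M_ij, and let Theta be *)
(*   det (theta_ij). By Cramer (a(x) - a(y)) Theta is in the ideal of the     *)
(*   f_i(x) - f_i(y). Apply in the variable x the functional                  *)
(*   p |-> (p o H)(0), which kills (f), and also a(x) Theta if a is in Ann H: *)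
(*   this gives a c in (f), where c has constant term (det M o H)(0) != 0.    *)
(*   By homogeneity a is in (f), so Ann H = (f).                              *)
(* - Suppose the x_i^(D+1) lie in (f), say x^(D+1) = A f = (A M) x. Then      *)
(*   det A multiplies (f) into (x_i^(D+1)), while det A det M is congruent to *)
(*   \prod_i x_i^D modulo that ideal, so det M is not in (f). For the powers  *)
(*   f_i^(E_i+1) in place of the f_i this says that \prod_i f_i^E_i det M is  *)
(*   not in (f_i^(E_i+1)). Every nonzero ideal of S/(f) contains det M when   *)
(*   (f) = Ann H, and this forces f to be a regular sequence.                 *)
(* - If Ann H = (f), then x_i^(deg H + 1) is in (f). So f has no common       *)
(*   projective zero, and det M o H != 0.                                     *)

Require Import Defs.

Set Implicit Arguments.
Unset Strict Implicit.
Unset Printing Implicit Defensive.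

Import GRing.Theory.
Local Open Scope ring_scope.

(** Everything turns on the class of [\det M] in S/(f), where [M] is the rescaled Jacobian
    [euler_mx]. By [socle_det] every variable kills this class, so when f annihilates H, [\det M]
    sends H to a constant; if that constant is nonzero, [Ann_sub_ideal] gives Ann H = (f), and
    comparing degrees gives deg H. Conversely, if Ann H = (f), then (f) contains a power of each
    variable, which excludes projective zeros, and [det_notin_ideal] keeps [\det M] out of (f). The
    same lemma, applied after deleting a generator, gives minimality. Regularity ([f_regular]) is
    proved through powers of f: [det_notin_powers] and [socle_multiple] force certain coefficients
    of a form evaluated at f to lie in (f). Hence if g f_i is in I = (f_j : j < i), then g is in I +
    (f)^t for every t, and so in I by homogeneity. *)

(** * Finitely generated ideals and Cramer's rule *)

Section IdealTheory.
Variables (A : comNzRingType) (r : nat).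
Implicit Types (f g : 'I_r -> A) (P Q : pred 'I_r).

Lemma in_ideal0 f P : in_ideal f P 0.
Proof.
by exists (fun=> 0); rewrite big1 // => i _; rewrite mul0r.
Qed.

Lemma in_idealD f P x y : in_ideal f P x -> in_ideal f P y -> in_ideal f P (x + y).
Proof.
move=> [c ->] [e ->]; exists (fun i => c i + e i).
by rewrite -big_split; apply: eq_bigr => i _; rewrite mulrDl.
Qed.

Lemma in_idealMl f P a x : in_ideal f P x -> in_ideal f P (a * x).
Proof.
move=> [c ->]; exists (fun i => a * c i).
by rewrite mulr_sumr; apply: eq_bigr => i _; rewrite mulrA.
Qed.

Lemma in_idealMr f P a x : in_ideal f P x -> in_ideal f P (x * a).
Proof. by rewrite mulrC; apply: in_idealMl. Qed.

Lemma in_idealN f P x : in_ideal f P x -> in_ideal f P (- x).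
Proof. by rewrite -mulN1r; apply: in_idealMl. Qed.

Lemma in_idealB f P x y : in_ideal f P x -> in_ideal f P y -> in_ideal f P (x - y).
Proof. by move=> fx fy; apply: in_idealD => //; apply: in_idealN. Qed.

Lemma in_ideal_gen f P i : P i -> in_ideal f P (f i).
Proof.
move=> Pi; exists (fun j => (j == i)%:R).
rewrite (bigD1 i) //= eqxx mul1r big1 ?addr0 // => j /andP[_ /negbTE->].
by rewrite mul0r.
Qed.

Lemma in_ideal_sum f P (I : Type) (s : seq I) (p : pred I) (x : I -> A) :
  (forall i, p i -> in_ideal f P (x i)) -> in_ideal f P (\sum_(i <- s | p i) x i).
Proof.
move=> fx; apply: (big_ind (in_ideal f P)) => //; first exact: in_ideal0.
exact: in_idealD.
Qed.

Lemma in_ideal_trans f g P Q x :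
  (forall i, P i -> in_ideal g Q (f i)) -> in_ideal f P x -> in_ideal g Q x.
Proof.
by move=> fg [c ->]; apply: in_ideal_sum => i Pi; apply/in_idealMl/fg.
Qed.

(** [h j - c i * f i] lies in the ideal of the unchanged generators and divides
    [h j ^+ e - (c i * f i) ^+ e]. *)
Lemma in_ideal_exp (f g : 'I_r -> A) (h : 'I_r -> A) i e :
    (forall j, j != i -> g j = f j) -> g i = f i ^+ e ->
    (forall j, in_ideal f predT (h j)) ->
  forall j, in_ideal g predT (h j ^+ e).
Proof.
move=> gf gi fh j; have [c hE] := fh j.
rewrite -[h j ^+ e](subrK ((c i * f i) ^+ e)); apply: in_idealD; last first.
  by rewrite exprMn -gi; apply/in_idealMl/in_ideal_gen.
rewrite subrXX; apply: in_idealMr; rewrite {1}hE (bigD1 i) //= addrC addrK.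
by apply: in_ideal_sum => l li; rewrite -gf //; apply/in_idealMl/in_ideal_gen.
Qed.

End IdealTheory.

Lemma cramer_rule (A : comNzRingType) (n : nat) (M : 'M[A]_n) (v : 'I_n -> A) j :
  \det M * v j = \sum_i \adj M j i * \sum_l M i l * v l.
Proof.
transitivity ((\adj M *m (M *m \col_l v l)) j ord0); last first.
  rewrite mxE; apply: eq_bigr => i _; congr (_ * _).
  by rewrite mxE; apply: eq_bigr => l _; rewrite mxE.
by rewrite mulmxA mul_adj_mx mul_scalar_mx !mxE.
Qed.

Lemma in_ideal_mul_det (A : comNzRingType) (n : nat) (M : 'M[A]_n)
    (u v : 'I_n -> A) a :
    (forall i, u i = \sum_l M i l * v l) ->
  in_ideal v predT a -> in_ideal u predT (\det M * a).
Proof.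
move=> uM [c ->]; rewrite mulr_sumr; apply: in_ideal_sum => j _.
rewrite mulrCA cramer_rule; apply/in_idealMl/in_ideal_sum => i _.
by rewrite -uM; apply/in_idealMl/in_ideal_gen.
Qed.

(** * Ideals of powers of variables; the determinant lies outside (f) *)

Section PowerIdeal.
Variables (k : fieldType) (n D : nat).
Implicit Types (P : pred 'I_n) (p q : {mpoly k[n]}).

(* The ideal generated by the 'X_j ^+ D.+1 with P j, in terms of monomials. *)
Definition pow_ideal P p :=
  forall m, m \in msupp p -> exists2 j, P j & (D < m j)%N.

Lemma pow_ideal0 P : pow_ideal P 0.
Proof. by move=> m; rewrite msupp0. Qed.

Lemma pow_idealD P p q : pow_ideal P p -> pow_ideal P q -> pow_ideal P (p + q).
Proof.
by move=> Pp Pq m /msuppD_le; rewrite mem_cat => /orP[/Pp|/Pq].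
Qed.

Lemma pow_idealMl P p q : pow_ideal P p -> pow_ideal P (q * p).
Proof.
move=> Pp m /msuppM_le/allpairsP[[m1 m2] /= [_ /Pp[j Pj Dj] ->]].
by exists j => //; rewrite mnmDE ltn_addl.
Qed.

Lemma pow_ideal_sum P (I : Type) (s : seq I) (Q : pred I) (F : I -> {mpoly k[n]}) :
  (forall i, Q i -> pow_ideal P (F i)) -> pow_ideal P (\sum_(i <- s | Q i) F i).
Proof.
move=> PF; apply: (big_ind (pow_ideal P)) => //; first exact: pow_ideal0.
exact: pow_idealD.
Qed.

Lemma pow_ideal_gen P j : P j -> pow_ideal P ('X_j ^+ D.+1).
Proof.
move=> Pj m; rewrite mpolyXn => /mem_msuppXP <-; exists j => //.
by rewrite mulmnE mnm1E eqxx mul1n.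
Qed.

Lemma pow_ideal_mulX P i p : ~~ P i -> pow_ideal P ('X_i * p) -> pow_ideal P p.
Proof.
move=> NPi Pp m mp; have [|j Pj] := Pp (U_(i) + m)%MM.
  by rewrite mcoeff_msupp mulrC mcoeffMX -mcoeff_msupp.
rewrite mnmDE mnm1E; case: eqVneq Pj NPi => [-> ->|_ Pj _] //; by exists j.
Qed.

(* Replace the rows of B by those of the diagonal matrix one at a time. The   *)
(* difference of two consecutive determinants is the determinant of a matrix  *)
(* C with C x = (x_i^(D+1)) except for a zero in position t, so by Cramer x_t *)
(* times it is in the ideal of the x_i^(D+1), i != t, modulo which x_t is     *)
(* regular.                                                                   *)
Lemma det_pow_ideal (B : 'M[{mpoly k[n]}]_n) :
    (forall i, \sum_j B i j * 'X_j = 'X_i ^+ D.+1) ->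
  pow_ideal predT (\det B - \prod_i 'X_i ^+ D).
Proof.
move=> BX.
pose mix t := \matrix_(i, j)
  (if (i < t)%N then 'X_i ^+ D *+ (i == j) else B i j) : 'M[{mpoly k[n]}]_n.
have mixX t i : \sum_j mix t i j * 'X_j = 'X_i ^+ D.+1.
  case: (ltnP i t) => [lt_it|le_ti]; last first.
    by rewrite -BX; apply: eq_bigr => j _; rewrite mxE ltnNge le_ti.
  rewrite (bigD1 i) //= mxE lt_it eqxx -exprSr big1 ?addr0 // => j.
  by rewrite mxE lt_it eq_sym => /negbTE->; rewrite mul0r.
have step (t : 'I_n) : pow_ideal predT (\det (mix t) - \det (mix t.+1)).
  pose C : 'M[{mpoly k[n]}]_n := \matrix_(i, j)
    (if i == t then mix t t j - mix t.+1 t j else mix t i j).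
  have -> : \det (mix t) = 1 * \det (mix t.+1) + 1 * \det C.
    apply: (determinant_multilinear (i0 := t)).
    - by apply/rowP => j; rewrite !mxE eqxx !ltnn ltnSn !mul1r addrC subrK.
    - apply/matrixP => i j; rewrite !mxE ltnS.
      have := neq_lift t i; rewrite -val_eqE eq_sym => /negbTE ti.
      by rewrite (leq_eqVlt (lift t i)) ti.
    - by apply/matrixP => i j; rewrite !mxE eq_sym (negbTE (neq_lift _ _)).
  rewrite !mul1r addrC addKr.
  have : pow_ideal (predC1 t) ('X_t * \det C).
    rewrite mulrC (cramer_rule _ (fun l => 'X_l)); apply: pow_ideal_sum => i _.
    apply: pow_idealMl; case: (eqVneq i t) => [->|ti].
      rewrite (eq_bigr (fun j => mix t t j * 'X_j - mix t.+1 t j * 'X_j)).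
        by rewrite sumrB !mixX subrr; apply: pow_ideal0.
      by move=> j _; rewrite mxE eqxx mulrBl.
    rewrite (eq_bigr (fun j => mix t i j * 'X_j)); last first.
      by move=> j _; rewrite mxE (negbTE ti).
    by rewrite mixX; apply: pow_ideal_gen.
  move/pow_ideal_mulX; rewrite /= eqxx => /(_ isT) CP m /CP[j _ Dj].
  by exists j.
have {step} mix0 t : (t <= n)%N -> pow_ideal predT (\det (mix 0) - \det (mix t)).
  elim: t => [|t IHt] lt_tn; first by rewrite subrr; apply: pow_ideal0.
  rewrite -[X in X - _](subrK (\det (mix t))) -addrA; apply: pow_idealD.
    exact/IHt/ltnW.
  exact: (step (Ordinal lt_tn)).
have <- : \det (mix n) = \prod_i 'X_i ^+ D.
  have -> : mix n = diag_mx (\row_i 'X_i ^+ D).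
    by apply/matrixP => i j; rewrite !mxE ltn_ord.
  by rewrite det_diag; apply: eq_bigr => i _; rewrite mxE.
have := mix0 n (leqnn n); congr (pow_ideal _ (\det _ - _)).
by apply/matrixP => i j; rewrite mxE.
Qed.

Lemma det_notin_ideal (f : 'I_n -> {mpoly k[n]}) (M : 'M[{mpoly k[n]}]_n) :
    (forall i, f i = \sum_j M i j * 'X_j) ->
    (forall i, in_ideal f predT ('X_i ^+ D.+1)) ->
  ~ in_ideal f predT (\det M).
Proof.
move=> fM /fin_all_exists[a Xa] [c Mc].
pose a' : 'M[{mpoly k[n]}]_n := \matrix_(i, j) a i j.
have aX i : \sum_j a' i j * f j = 'X_i ^+ D.+1.
  by rewrite Xa; apply: eq_bigr => j _; rewrite mxE.
have /det_pow_ideal : forall i, \sum_j (a' *m M) i j * 'X_j = 'X_i ^+ D.+1.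
  move=> i; rewrite -aX; under eq_bigr do rewrite mxE mulr_suml.
  rewrite exchange_big; apply: eq_bigr => l _ /=.
  by rewrite fM mulr_sumr; apply: eq_bigr => j _; rewrite mulrA.
rewrite det_mulmx => PaM.
have Pdet : pow_ideal predT (\det a' * \det M).
  rewrite Mc mulr_sumr; apply: pow_ideal_sum => j _.
  rewrite mulrCA; apply: pow_idealMl; rewrite cramer_rule.
  by apply: pow_ideal_sum => i _; rewrite aX; apply/pow_idealMl/pow_ideal_gen.
have : pow_ideal predT (\prod_(i < n) 'X_i ^+ D : {mpoly k[n]}).
  have := pow_idealD Pdet (@pow_idealMl _ _ (-1) PaM).
  by rewrite mulN1r opprB addrC subrK.
have -> : \prod_(i < n) 'X_i ^+ D = 'X_[[multinom D | i < n]] :> {mpoly k[n]}.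
  by rewrite mpolyXE_id; apply: eq_bigr => i _; rewrite mnmE.
move/(_ [multinom D | i < n]); rewrite msuppX mem_head => /(_ isT)[j _].
by rewrite mnmE ltnn.
Qed.

End PowerIdeal.

(** * The action by derivation *)

Section Apolarity.
Variables (k : fieldType) (n : nat).
Implicit Types (p q g G H : {mpoly k[n]}) (m : 'X_{1..n}).

Lemma apolarwE K p H : (msize p <= K)%N ->
  apolar p H = \sum_(m : 'X_{1..n < K}) p@_m *: H^`M[m].
Proof.
move=> le_pK; rewrite /apolar (ssrcomplements.big_mksub 'X_{1..n < K}) ?msupp_uniq //=.
  by rewrite big_rmcond //= => m /memN_msupp_eq0->; rewrite scale0r.
by move=> m /msize_mdeg_lt /leq_trans; apply.
Qed.

Lemma apolar_is_linear H : linear (fun p => apolar p H).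
Proof.
move=> c p q; set K := maxn (msize (c *: p + q)) (maxn (msize p) (msize q)).
rewrite !(@apolarwE K) ?leq_maxl ?leq_max ?leqnn ?orbT //.
rewrite scaler_sumr -big_split; apply: eq_bigr => m _ /=.
by rewrite mcoeffD mcoeffZ scalerDl scalerA.
Qed.

Lemma apolar0 H : apolar 0 H = 0.
Proof. by rewrite /apolar msupp0 big_nil. Qed.

Lemma apolarZ c p H : apolar (c *: p) H = c *: apolar p H.
Proof. by rewrite -[c *: p]addr0 apolar_is_linear apolar0 addr0. Qed.

Lemma apolarD p q H : apolar (p + q) H = apolar p H + apolar q H.
Proof. by rewrite -[p]scale1r apolar_is_linear !scale1r. Qed.

Lemma apolarB p q H : apolar (p - q) H = apolar p H - apolar q H.
Proof. by rewrite apolarD -scaleN1r apolarZ scaleN1r. Qed.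

Lemma apolar_sum (I : Type) (s : seq I) (P : pred I) (F : I -> {mpoly k[n]}) H :
  apolar (\sum_(i <- s | P i) F i) H = \sum_(i <- s | P i) apolar (F i) H.
Proof.
by elim/big_rec2: _ => [|i _ p _ <-]; rewrite ?apolar0 ?apolarD.
Qed.

Lemma apolarXm m H : apolar 'X_[m] H = H^`M[m].
Proof. by rewrite /apolar msuppX big_seq1 mcoeffX eqxx scale1r. Qed.

Lemma apolar1 H : apolar 1 H = H.
Proof. by rewrite -mpolyX0 apolarXm mderivm0m. Qed.

Lemma apolarp0 p : apolar p 0 = 0.
Proof. by rewrite /apolar big1 // => m _; rewrite raddf0 scaler0. Qed.

Lemma apolarM p q H : apolar (p * q) H = apolar p (apolar q H).
Proof.
have apolarXM m r : apolar ('X_[m] * r) H = (apolar r H)^`M[m].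
  rewrite [in LHS](mpolyE r) mulr_sumr apolar_sum [in RHS]/apolar.
  rewrite [RHS]raddf_sum; apply: eq_bigr => m' _ /=.
  by rewrite -scalerAr apolarZ -mpolyXD apolarXm addmC mderivmDm mderivmZ.
rewrite [in LHS](mpolyE p) mulr_suml apolar_sum.
by apply: eq_bigr => m _; rewrite -scalerAl apolarZ apolarXM.
Qed.

Lemma Ann_ideal r (f : 'I_r -> {mpoly k[n]}) (P : pred 'I_r) H g :
  (forall i, P i -> Ann H (f i)) -> in_ideal f P g -> Ann H g.
Proof.
move=> fH [c ->]; rewrite /Ann apolar_sum big1 // => i Pi.
by rewrite apolarM (fH i Pi) apolarp0.
Qed.

Lemma mcoeff0_mderivm m H : (H^`M[m])@_0 = H@_m *+ \prod_(i < n) (m i)`!.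
Proof.
rewrite mcoeff_mderivm addm0; congr (_ *+ _).
by apply: eq_bigr => i _; rewrite ffactnn.
Qed.

(** Summing over the support of [H] rather than of [p] gives a fixed finite linear form in the
    coefficients of [p], the shape that [residue] extends to coefficients in S. *)
Lemma mcoeff0_apolar p H :
  (apolar p H)@_0 = \sum_(m <- msupp H) (H^`M[m])@_0 * p@_m.
Proof.
pose K := maxn (msize p) (msize H); rewrite (@apolarwE K) ?leq_maxl //.
rewrite raddf_sum (ssrcomplements.big_mksub 'X_{1..n < K}) ?msupp_uniq //=; last first.
  by move=> m /msize_mdeg_lt lt_mH; rewrite leq_max lt_mH orbT.
rewrite [RHS]big_rmcond /=; last first.
  by move=> m /memN_msupp_eq0 Hm; rewrite mcoeff0_mderivm Hm mul0rn mul0r.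
by apply: eq_bigr => m _; rewrite mcoeffZ mulrC.
Qed.

End Apolarity.

(** * Order of vanishing at the origin and homogeneous ideals *)

Section Order.
Variables (k : fieldType) (n : nat).
Implicit Types (p q g : {mpoly k[n]}).

Definition order_ge t p := forall m, m \in msupp p -> (t <= mdeg m)%N.

Lemma order_ge0 t : order_ge t 0.
Proof. by move=> m; rewrite msupp0. Qed.

Lemma order_geD t p q : order_ge t p -> order_ge t q -> order_ge t (p + q).
Proof. by move=> tp tq m /msuppD_le; rewrite mem_cat => /orP[/tp|/tq]. Qed.

Lemma order_geM s t p q : order_ge s p -> order_ge t q -> order_ge (s + t) (p * q).
Proof.
move=> sp tq m /msuppM_le/allpairsP[[m1 m2] /= [/sp sm1 /tq tm2 ->]].
by rewrite mdegD leq_add.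
Qed.

Lemma order_ge_const p : p@_0 = 0 -> order_ge 1 p.
Proof.
move=> p0 m; rewrite mcoeff_msupp lt0n mdeg_eq0; apply: contraNneq => ->.
by rewrite p0.
Qed.

Lemma order_geX t p : order_ge 1 p -> order_ge t (p ^+ t).
Proof.
by move=> p1; elim: t => [//|t IHt]; rewrite exprS; apply: (@order_geM 1).
Qed.

Lemma homog_order_ge e p : p \is e.-homog -> order_ge e p.
Proof. by move/dhomogP => pe m /pe->. Qed.

Lemma pihomog_order_ge t e p : (e < t)%N -> order_ge t p -> pihomog mdeg e p = 0.
Proof.
move=> et tp; rewrite pihomogE big_seq_cond big1 // => m /andP[/tp tm /eqP em].
by rewrite /= in em; move: tm; rewrite em leqNgt et.
Qed.

Section HomogeneousIdeal.
Variables (r : nat) (f : 'I_r -> {mpoly k[n]}) (d : 'I_r -> nat).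
Hypothesis f_homog : forall i, f i \is (d i).-homog.

Lemma in_ideal_pihomog P e g :
  in_ideal f P g -> in_ideal f P (pihomog mdeg e g).
Proof.
move=> [c ->]; rewrite raddf_sum; apply: in_ideal_sum => i Pi /=.
rewrite [c i](@pihomog_partitionE _ _ mdeg (msize (c i))) // mulr_suml raddf_sum.
apply: in_ideal_sum => j _ /=.
have hom : pihomog mdeg j (c i) * f i \is (j + d i).-homog.
  by apply: dhomogM => //; apply: pihomogP.
have [<-|ne] := eqVneq (j + d i)%N e.
  by rewrite pihomog_dE //; apply/in_idealMl/in_ideal_gen.
by rewrite (pihomog_ne0 ne) //; apply: in_ideal0.
Qed.

(** Krull intersection for a homogeneous ideal: an approximation of [g] to order [msize g] has the
    same homogeneous components as [g] in all degrees below [msize g], and the ideal contains the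
    components of its elements. *)
Lemma in_ideal_krull P g :
  (forall t, exists2 u, in_ideal f P u & order_ge t (g - u)) -> in_ideal f P g.
Proof.
move=> /(_ (msize g))[u fu gu].
have fg (e : nat) : (e < msize g)%N -> in_ideal f P (pihomog mdeg e g).
  move=> lt_eg; rewrite -[g](subrK u) pihomogD (pihomog_order_ge lt_eg gu) add0r.
  exact: in_ideal_pihomog.
rewrite [g](@pihomog_partitionE _ _ mdeg (msize g)) //.
by apply: in_ideal_sum => e _; apply: fg.
Qed.

End HomogeneousIdeal.
End Order.

(** * Differences p(x) - p(y) and the duality argument *)

Section Specialization.

Lemma mmap_sub_in_ideal (n : nat) (R S : comNzRingType) (iota : {rmorphism R -> S})
    (u v : 'I_n -> S) (p : {mpoly R[n]}) :
  in_ideal (fun j => u j - v j) predT (mmap iota u p - mmap iota v p).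
Proof.
rewrite /mmap -sumrB; apply: in_ideal_sum => m _; rewrite -mulrBr.
apply: in_idealMl; rewrite /mmap1.
elim/big_ind2: _ => [|x2 x1 y2 y1 fx fy|i _].
- by rewrite subrr; apply: in_ideal0.
- have -> : x1 * y1 - x2 * y2 = (x1 - x2) * y1 + x2 * (y1 - y2).
    by rewrite mulrBl mulrBr addrA subrK.
  by apply: in_idealD; [apply: in_idealMr | apply: in_idealMl].
by rewrite subrXX; apply: in_idealMr; apply: (in_ideal_gen (fun j => u j - v j)).
Qed.

Lemma rmorph_mmap (n : nat) (R : nzRingType) (S S' : comNzRingType)
    (iota : {rmorphism R -> S}) (u : 'I_n -> S) (g : {rmorphism S -> S'}) p :
  g (mmap iota u p) = mmap (g \o iota) (g \o u) p.
Proof.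
rewrite /mmap rmorph_sum; apply: eq_bigr => m _; rewrite rmorphM; congr (_ * _).
by rewrite /mmap1 rmorph_prod; apply: eq_bigr => i _; rewrite rmorphXn.
Qed.

End Specialization.

Section Duality.
Variables (k : fieldType) (n : nat).
Local Notation S := {mpoly k[n]}.
Local Notation T := {mpoly {mpoly k[n]}[n]}.

(* In T the outer variables are the x_j and the inner ones the y_j: the image *)
(* of p in T is p(x) under map_mpoly (mpolyC n) and p(y) under mpolyC n.      *)
Local Notation inX := (map_mpoly (@mpolyC n k)).
Local Notation inY p := ((p : S)%:MP : T).
Local Notation at_y0 := (map_mpoly (mcoeff (0%MM : 'X_{1..n}))).

Lemma mmap_mpolyCX (p : S) : mmap (@mpolyC n k) (fun j => 'X_j) p = p.
Proof.
rewrite {2}(mpolyE p) /mmap.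
by apply: eq_bigr => m _; rewrite mmap1_id mul_mpolyC.
Qed.

Lemma mmap_inY (p : S) :
  mmap (@mpolyC n S \o @mpolyC n k) (fun j => inY 'X_j) p = inY p.
Proof. by rewrite -[in RHS](mmap_mpolyCX p) [RHS]rmorph_mmap. Qed.

Lemma at_y0_inX (p : S) : at_y0 (inX p) = p.
Proof. by apply/mpolyP => m; rewrite !mcoeff_map_mpoly /= mpolyCK. Qed.

Lemma at_y0_inY (p : S) : at_y0 (inY p) = (p@_0)%:MP.
Proof. exact: map_mpolyC. Qed.

Lemma inX_sub_inY (p : S) :
  in_ideal (fun j => 'X_j - inY 'X_j) predT (inX p - inY p).
Proof.
have := mmap_sub_in_ideal (@mpolyC n S \o @mpolyC n k)
  (fun j => 'X_j) (fun j => inY 'X_j) p.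
by rewrite mmap_inY.
Qed.

(* p(x) - p(y) = \sum_j theta_j (x_j - y_j), where moreover theta_j(x, 0) can *)
(* be prescribed: from any theta subtract delta(x - y), where delta is the    *)
(* error theta(x, 0) - M.                                                     *)
Lemma difference_quotient (p : S) (M : 'I_n -> S) :
    p = \sum_j M j * 'X_j ->
  exists theta : 'I_n -> T,
    inX p - inY p = \sum_j theta j * ('X_j - inY 'X_j)
    /\ forall j, at_y0 (theta j) = M j.
Proof.
move=> pM.
have [th0 pth] := inX_sub_inY p.
pose delta j := at_y0 (th0 j) - M j.
pose V := mmap (@mpolyC n S \o @mpolyC n k) (fun j => 'X_j - inY 'X_j).
have at0XY j : at_y0 ('X_j - inY 'X_j) = 'X_j.
  rewrite raddfB /= at_y0_inY mcoeffX mnm1_eq0 mpolyC0 subr0.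
  by rewrite map_mpolyX.
have p0 : p@_0 = 0.
  rewrite pM raddf_sum big1 // => j _ /=.
  by rewrite rmorphM /= mcoeffX mnm1_eq0 mulr0.
have pE : p = \sum_j at_y0 (th0 j) * 'X_j.
  have := congr1 at_y0 pth; rewrite raddfB /= at_y0_inX at_y0_inY p0 mpolyC0 subr0.
  rewrite raddf_sum => {1}->; apply: eq_bigr => j _ /=.
  by rewrite [LHS]rmorphM /= at0XY.
have deltaX : \sum_j delta j * 'X_j = 0.
  by under eq_bigr do rewrite mulrBl; rewrite sumrB -pE -pM subrr.
exists (fun j => th0 j - V (delta j)); split=> [|j]; last first.
  rewrite raddfB /= [at_y0 (V _)]rmorph_mmap /=.
  rewrite -[X in _ - X = _](_ : delta j = _); first by rewrite opprB addrC subrK.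
  rewrite -[LHS]mmap_mpolyCX; rewrite /mmap; apply: eq_bigr => m _.
  congr (_ * _); last by apply: mmap1_eq => i /=; rewrite at0XY.
  by rewrite /= map_mpolyC /= mpolyCK.
under eq_bigr do rewrite mulrBl; rewrite sumrB -pth.
have -> : \sum_j V (delta j) * ('X_j - inY 'X_j) = V (\sum_j delta j * 'X_j).
  rewrite [RHS]rmorph_sum; apply: eq_bigr => j _.
  by rewrite [RHS]rmorphM /= mmapX mmap1U.
by rewrite deltaX [V 0]raddf0 subr0.
Qed.

Variable H : S.

(* The S-linear extension to T of p |-> (p o H)(0). *)
Definition residue (p : T) : S := \sum_(m <- msupp H) (H^`M[m])@_0 *: p@_m.

Lemma residueD p q : residue (p + q) = residue p + residue q.
Proof.
rewrite /residue -big_split; apply: eq_bigr => m _.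
by rewrite mcoeffD scalerDr.
Qed.

Lemma residue0 : residue 0 = 0.
Proof. by rewrite /residue big1 // => m _; rewrite mcoeff0 scaler0. Qed.

Lemma residueZ (s : S) p : residue (s *: p) = s * residue p.
Proof.
rewrite /residue mulr_sumr; apply: eq_bigr => m _.
by rewrite mcoeffZ scalerAr.
Qed.

Lemma residue_sum (I : Type) (s : seq I) (P : pred I) (F : I -> T) :
  residue (\sum_(i <- s | P i) F i) = \sum_(i <- s | P i) residue (F i).
Proof.
by elim/big_rec2: _ => [|i _ p _ <-]; rewrite ?residue0 ?residueD.
Qed.

Lemma residue_inX (p : S) : residue (inX p) = ((apolar p H)@_0)%:MP.
Proof.
rewrite mcoeff0_apolar /residue raddf_sum; apply: eq_bigr => m _ /=.
by rewrite mcoeff_map_mpoly /= mpolyCM mul_mpolyC.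
Qed.

Lemma residue_Ann (g : S) q : Ann H g -> residue (inX g * q) = 0.
Proof.
move=> gH; rewrite (mpolyE q) mulr_sumr residue_sum big1 // => m _.
rewrite -scalerAr residueZ -(map_mpolyX (@mpolyC n k) m) -rmorphM.
by rewrite residue_inX (mulrC g) apolarM gH apolarp0 mcoeff0 mpolyC0 mulr0.
Qed.

Lemma mcoeff0_residue p : (residue p)@_0 = (apolar (at_y0 p) H)@_0.
Proof.
rewrite mcoeff0_apolar /residue raddf_sum; apply: eq_bigr => m _ /=.
by rewrite mcoeffZ mcoeff_map_mpoly.
Qed.

(* With w = 1 - c / c(0), a c in (f) gives a - a w^t in (f) for all t, and w  *)
(* has no constant term.                                                      *)
Lemma Ann_sub_ideal (f : 'I_n -> S) (d : 'I_n -> nat) (M : 'M[S]_n) (a : S) :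
    (forall i, f i \is (d i).-homog) ->
    (forall i, f i = \sum_j M i j * 'X_j) ->
    (forall i, Ann H (f i)) ->
    (apolar (\det M) H)@_0 != 0 ->
  Ann H a -> in_ideal f predT a.
Proof.
move=> f_homog fM fH detH aH.
have /fin_all_exists[th /all_and2[fth th0]] : forall i, exists theta : 'I_n -> T,
    inX (f i) - inY (f i) = \sum_j theta j * ('X_j - inY 'X_j)
    /\ forall j, at_y0 (theta j) = M i j.
  by move=> i; apply/difference_quotient/fM.
pose Th : 'M[T]_n := \matrix_(i, j) th i j.
pose c := residue (\det Th).
have c0 : c@_0 = (apolar (\det M) H)@_0.
  rewrite mcoeff0_residue -det_map_mx; congr ((apolar (\det _) H)@_0).
  by apply/matrixP => i j; rewrite !mxE; apply: th0.
have [e aTh] : in_ideal (fun i => inX (f i) - inY (f i)) predT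
    ((inX a - inY a) * \det Th).
  rewrite mulrC; apply: (in_ideal_mul_det _ (inX_sub_inY a)) => i.
  by rewrite fth; apply: eq_bigr => j _; rewrite mxE.
have fac : in_ideal f predT (a * c).
  have := congr1 residue aTh; rewrite mulrBl residueD residue_Ann // add0r.
  rewrite -mulNr -mpolyCN mul_mpolyC residueZ mulNr => /eqP.
  rewrite eqr_oppLR => /eqP ->; apply: in_idealN; rewrite residue_sum.
  apply: in_ideal_sum => i _.
  rewrite mulrC mulrBl residueD residue_Ann // add0r.
  rewrite -mulNr -mpolyCN mul_mpolyC residueZ mulNr mulrC.
  by apply/in_idealN/in_idealMl/in_ideal_gen.
pose w := 1 - (c@_0)^-1 *: c.
have w1 : order_ge 1 w.
  by apply: order_ge_const; rewrite mcoeffB mcoeffZ mcoeff1 eqxx c0 mulVf ?subrr.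
apply: (in_ideal_krull f_homog) => t; exists (a * (1 - w ^+ t)); last first.
  rewrite mulrBr mulr1 opprB addrC subrK.
  by apply: (@order_geM _ _ 0 t) => //; apply: order_geX.
rewrite -(expr1n _ t) subrXX mulrA; apply: in_idealMr.
by rewrite opprB addrC subrK -scalerAr -mul_mpolyC; apply: in_idealMl.
Qed.

End Duality.

(** * Euler's formula and derivatives in characteristic zero *)

Section Euler.
Variables (k : fieldType) (n : nat).
Implicit Types (p G H : {mpoly k[n]}).

Lemma euler_homog e p :
  p \is e.-homog -> \sum_j p^`M(j) * 'X_j = e%:R *: p.
Proof.
move=> /dhomogP pe; rewrite [in RHS](mpolyE p) scaler_sumr.
have derX m j : ('X_[m] : {mpoly k[n]})^`M(j) * 'X_j = (m j)%:R *: 'X_[m].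
  rewrite mderivX -scalerAl -mpolyXD.
  have [->|mj] := eqVneq (m j) 0%N; first by rewrite !scale0r.
  by rewrite submK // lep1mP.
under eq_bigr do rewrite {1}(mpolyE p) raddf_sum mulr_suml.
rewrite exchange_big big_seq [RHS]big_seq; apply: eq_bigr => m /pe <- /=.
under eq_bigr do rewrite mderivZ -scalerAl derX scalerA mulrC -scalerA.
by rewrite -scaler_suml -natr_sum mdegE.
Qed.

Lemma apolarXn_eq0 e H i : H \is e.-homog -> apolar ('X_i ^+ e.+1) H = 0.
Proof.
move=> He; rewrite mpolyXn apolarXm; apply/mpolyP => m.
rewrite mcoeff_mderivm mcoeff0 (dhomog_nemf_coeff He) ?mul0rn //=.
by rewrite mdegD mdegMn mdeg1 mul1n eqn_leq addSn ltnNge leq_addr.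
Qed.

Hypothesis char0 : [pchar k] =i pred0.

Lemma natr_char0_eq0 e : ((e%:R : k) == 0) = (e == 0%N).
Proof. by move/pcharf0P: char0 => ->. Qed.

Lemma mderiv0_const G : (forall j, G^`M(j) = 0) -> G = (G@_0)%:MP.
Proof.
move=> G0; apply/mpolyP => m; rewrite mcoeffC.
have [->|m0] := eqVneq m 0%MM; first by rewrite mulr1.
rewrite mulr0; have [j mj] : exists j, m j != 0%N.
  apply/existsP; apply: contraNT m0; rewrite negb_exists => /forallP m0.
  by apply/eqP/mnmP => j; rewrite mnm0E; apply/eqP; rewrite -[_ == _]negbK m0.
have := congr1 (mcoeff (m - U_(j))%MM) (G0 j).
rewrite mcoeff_mderiv mcoeff0 submK ?lep1mP // => /eqP.
by rewrite -mulr_natr mulf_eq0 natr_char0_eq0 orbF => /eqP.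
Qed.

(** The leading monomial has maximal degree, so this derivative kills all other monomials of [G];
    characteristic zero keeps the product of factorials nonzero. *)
Lemma mderivm_mlead G : G != 0 ->
  exists2 c, c != 0 & G^`M[mlead G] = c%:MP.
Proof.
move=> G0; set m := mlead G.
exists (G@_m *+ \prod_(i < n) (m i)`!).
  rewrite -mulr_natr mulf_neq0 ?mleadc_eq0 // natr_char0_eq0.
  by rewrite -lt0n prodn_gt0 // => i; apply: fact_gt0.
apply/mpolyP => a; rewrite mcoeffC.
have [->|a0] := eqVneq a 0%MM; first by rewrite mulr1 mcoeff0_mderivm.
rewrite mulr0 mcoeff_mderivm memN_msupp_eq0 ?mul0rn //.
by apply: msize_mdeg_ge; rewrite -mlead_deg // mdegD -addn1 leq_add2l lt0n mdeg_eq0.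
Qed.

End Euler.

(** * Annihilators generated by as many forms as variables *)

Section CompleteIntersection.
Variables (k : fieldType) (n : nat).
Hypothesis char0 : [pchar k] =i pred0.
Variables (H : {mpoly k[n]}) (e : nat).
Hypotheses (H0 : H != 0) (He : H \is e.-homog).
Variables (f : 'I_n -> {mpoly k[n]}) (d : 'I_n -> nat) (M : 'M[{mpoly k[n]}]_n).
Hypothesis f_homog : forall i, f i \is (d i).-homog.
Hypothesis d_gt0 : forall i, (0 < d i)%N.
Hypothesis fM : forall i, f i = \sum_j M i j * 'X_j.

Lemma socle_det j : in_ideal f predT ('X_j * \det M).
Proof.
rewrite mulrC; apply: (in_ideal_mul_det (v := fun l => 'X_l)) => //.
exact: (in_ideal_gen (fun l => 'X_l)).
Qed.

(** Each partial derivative vanishes because ['X_j * \det M] lies in (f). *)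
Lemma apolar_det_const : (forall i, Ann H (f i)) ->
  apolar (\det M) H = ((apolar (\det M) H)@_0)%:MP.
Proof.
move=> fH; apply: mderiv0_const => // j.
rewrite -mderivmU1m -apolarXm -apolarM.
by apply: (Ann_ideal _ (socle_det j)) => i _.
Qed.

Lemma Ann_eq_ideal g : (forall i, Ann H (f i)) -> apolar (\det M) H != 0 ->
  Ann H g <-> in_ideal f predT g.
Proof.
move=> fH detH; split; last by apply: Ann_ideal => i _.
apply: (Ann_sub_ideal f_homog fM) => //; apply: contra detH => /eqP det0.
by rewrite apolar_det_const // det0 mpolyC0.
Qed.

Hypothesis AnnH : forall g, Ann H g <-> in_ideal f predT g.

Lemma X_exp_in_ideal i : in_ideal f predT ('X_i ^+ e.+1).
Proof. by apply/AnnH; apply: apolarXn_eq0. Qed.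

Lemma det_nonAnn : apolar (\det M) H != 0.
Proof.
apply/eqP => /AnnH; exact: (det_notin_ideal fM X_exp_in_ideal).
Qed.

Lemma no_projective_zero : ~ common_projective_zero f.
Proof.
move=> [v [[i vi] fv]]; have [c] := X_exp_in_ideal i.
move/(congr1 (meval v)); rewrite rmorphXn /= mevalXU raddf_sum big1.
  by move/eqP; rewrite expf_eq0 (negbTE vi) andbF.
by move=> j _ /=; rewrite mevalM fv mulr0.
Qed.

Lemma f_minimal : minimally_generates f (Ann H).
Proof.
split=> // J genJ; apply/setP => i; rewrite inE; apply/negPn/negP => iJ.
(* Replacing f_i by 0 does not change the ideal, but makes det M vanish. *)
pose g j := if j == i then 0 else f j.
pose N := \matrix_(j, l) (if j == i then 0 else M j l).
have gN j : g j = \sum_l N j l * 'X_l.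
  rewrite /g; case: eqP => [->|/eqP ji].
    by rewrite big1 // => l _; rewrite mxE eqxx mul0r.
  by rewrite fM; apply: eq_bigr => l _; rewrite mxE (negbTE ji).
have Xg j : in_ideal g predT ('X_j ^+ e.+1).
  have /AnnH/genJ := X_exp_in_ideal j; apply: in_ideal_trans => l Jl.
  have -> : f l = g l by rewrite /g; case: eqP => // li; case/negP: iJ; rewrite -li.
  exact: in_ideal_gen.
apply: (det_notin_ideal gN Xg).
rewrite (expand_det_row _ i) big1; first exact: in_ideal0.
by move=> l _; rewrite mxE eqxx mul0r.
Qed.

Lemma det_notin_powers (E : 'X_{1..n}) :
  ~ in_ideal (fun j => f j ^+ (E j).+1) predT (\det M * \prod_j f j ^+ E j).
Proof.
have [D XD] : exists D, forall i,
    in_ideal (fun j => f j ^+ (E j).+1) predT ('X_i ^+ D.+1 : {mpoly k[n]}).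
  (* Pass to the powers one generator at a time; by [in_ideal_exp], replacing [f i] costs raising
     the known powers of the variables to the exponent [(E i).+1]. *)
  pose g t (j : 'I_n) := if (j < t)%N then f j ^+ (E j).+1 else f j.
  have XD t : (t <= n)%N -> exists D, forall i, in_ideal (g t) predT ('X_i ^+ D.+1).
    elim: t => [_|t IHt lt_tn]; first by exists e; apply: X_exp_in_ideal.
    have [D XD] := IHt (ltnW lt_tn); pose i := Ordinal lt_tn.
    exists (D.+1 * (E i).+1).-1 => j; rewrite prednK // exprM.
    apply: (in_ideal_exp (f := g t) (i := i) _ _ XD) => [l li|]; last first.
      by rewrite /g ltnn ltnSn.
    by rewrite /g ltnS leq_eqVlt -[_ == _ :> nat]/(l == i) (negbTE li).
  have [D {}XD] := XD n (leqnn n).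
  exists D => i; apply: in_ideal_trans (XD i) => j _; rewrite /g ltn_ord.
  exact: (in_ideal_gen (fun j => f j ^+ (E j).+1)).
(* [N] plays the role of [M] for the family of powers. *)
pose N := \matrix_(i, j) (f i ^+ E i * M i j).
have -> : \det M * \prod_j f j ^+ E j = \det N.
  have -> : N = diag_mx (\row_i f i ^+ E i) *m M.
    by apply/matrixP => i j; rewrite mul_diag_mx !mxE.
  rewrite det_mulmx det_diag mulrC; congr (_ * _).
  by apply: eq_bigr => i _; rewrite mxE.
apply: (det_notin_ideal _ XD) => i; rewrite exprSr {2}fM mulr_sumr.
by apply: eq_bigr => j _; rewrite mxE mulrA.
Qed.

(** A suitable derivative of [apolar g H] is a nonzero constant, and [apolar (\det M) H] is a
    constant too, so a scalar matches them. *)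
Lemma socle_multiple g : ~ Ann H g -> exists b, Ann H (b * g - \det M).
Proof.
move=> gH; have /(mderivm_mlead char0)[c c0 cE] : apolar g H != 0 by apply/eqP.
set m := mlead _ in cE; pose u := (apolar (\det M) H)@_0.
exists ((u / c) *: 'X_[m]).
rewrite /Ann apolarB -scalerAl apolarZ apolarM apolarXm cE.
rewrite apolar_det_const => [|i]; last exact/AnnH/in_ideal_gen.
by rewrite -mul_mpolyC -mpolyCM divfK // subrr.
Qed.

Local Notation fm := (mmap1 f).

Lemma fmD m1 m2 : fm (m1 + m2) = fm m1 * fm m2.
Proof. by apply: commr_mmap1_M => j x; apply: mulrC. Qed.

Lemma fm_in_ideal (E m : 'X_{1..n}) (P : pred 'I_n) j : P j -> (E j < m j)%N ->
  in_ideal (fun j => f j ^+ (E j).+1) P (fm m).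
Proof.
move=> Pj /subnKC Em; rewrite /mmap1 (bigD1 j) //= -Em exprD -mulrA.
by apply: in_idealMr; apply: (in_ideal_gen (fun j => f j ^+ (E j).+1)).
Qed.

Lemma fm_in_partial (m : 'X_{1..n}) (P : pred 'I_n) j : P j -> (0 < m j)%N ->
  in_ideal f P (fm m).
Proof.
move=> Pj mj; rewrite /mmap1 (bigD1 j) //= -(prednK mj) exprS -mulrA.
by apply/in_idealMr/in_ideal_gen.
Qed.

Lemma mnm_exists_lt (m1 m2 : 'X_{1..n}) :
  mdeg m1 = mdeg m2 -> m1 != m2 -> exists j, (m1 j < m2 j)%N.
Proof.
move=> dm ne; apply/existsP; apply: contraNT ne; rewrite negb_exists => /forallP le.
have le21 : (m2 <= m1)%MM by apply/mnm_lepP => j; rewrite leqNgt le.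
have := dm; rewrite -(submK le21) mdegD => /eqP.
by rewrite -[X in _ == X]add0n eqn_add2r mdeg_eq0 => /eqP->; rewrite add0m.
Qed.

(* If F_m o H != 0, pick b with b F_m = det M modulo (f). In b f^(L - m) f_i  *)
(* F(f) all terms but that of m are in (f_j^(E_j+1)), where E = L + U_i: this *)
(* puts det M f^E in that ideal, contradicting [det_notin_powers].            *)
Lemma regular_coef (i : 'I_n) t (F : {mpoly {mpoly k[n]}[n]}) m :
    F \is t.-homog -> m \in msupp F -> (forall j : 'I_n, (j < i)%N -> m j = 0%N) ->
    in_ideal f (fun j : 'I_n => (j < i)%N) (F.@[f] * f i) ->
  Ann H F@_m.
Proof.
move=> Ft Fm m0 Ffi; have [//|/eqP FmH] := eqVneq (apolar F@_m H) 0.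
have [b bF] := socle_multiple FmH; exfalso.
have dm : mdeg m = t by apply: (dhomog_mf Ft).
pose L : 'X_{1..n} := [multinom if (j < i)%N then 0%N else t | j < n].
pose E : 'X_{1..n} := (L + U_(i))%MM.
have mL : (m <= L)%MM.
  apply/mnm_lepP => j; rewrite mnmE; case: ltnP => [/m0->//|_].
  by rewrite -dm mdegE (bigD1 j) //= leq_addr.
pose Q := in_ideal (fun j => f j ^+ (E j).+1) predT.
(* Thus for [j < i] the generator is [f j] itself, and the hypothesis on [F.@[f] * f i] carries over
   to [Q]. *)
have E0 (j : 'I_n) : (j < i)%N -> E j = 0%N.
  move=> ji; rewrite mnmDE mnmE ji mnm1E.
  by case: eqP ji => // ->; rewrite ltnn.
have QF : Q (b * fm (L - m) * (F.@[f] * f i)).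
  apply: in_idealMl; apply: in_ideal_trans Ffi => j ji.
  have -> : f j = f j ^+ (E j).+1 by rewrite E0.
  exact: (in_ideal_gen (fun j => f j ^+ (E j).+1)).
have Qm : Q (b * F@_m * fm E).
  move: QF; rewrite mevalE (bigD1_seq m) ?msupp_uniq //= mulrDl mulrDr.
  set R := (X in _ + X); have QR : Q R.
    rewrite /R big_seq_cond mulr_suml mulr_sumr; apply: in_ideal_sum.
    move=> m' /andP[Fm' m'm]; have dm' : mdeg m' = t by apply: (dhomog_mf Ft).
    rewrite -[\prod_i _]/(fm m') -(mmap1U f i).
    have -> : b * fm (L - m) * (F@_m' * fm m' * fm U_(i)) =
              (b * F@_m') * fm (L - m + m' + U_(i)).
      by rewrite !fmD -!mulrA; congr (_ * _); rewrite mulrCA.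
    (* Having the same degree as [m], the monomial [m'] exceeds it at some [j], where the total
       exponent then exceeds [E j]. *)
    have [||j mj] := @mnm_exists_lt m m'; rewrite ?dm // 1?eq_sym //.
    apply/in_idealMl/(@fm_in_ideal _ _ _ j) => //.
    rewrite /E !mnmDE ltn_add2r mnmBE.
    by rewrite -{1}(subnK (mnm_lepP mL j)) ltn_add2l.
  move=> QFR; have := in_idealB QFR QR; rewrite addrK.
  rewrite -[\prod_i _]/(fm m) -(mmap1U f i).
  congr Q; rewrite /E -[in RHS](submK mL) !fmD -!mulrA; congr (_ * _).
  by rewrite mulrCA.
apply: (@det_notin_powers E); rewrite -/(mmap1 f E).
have -> : \det M = b * F@_m - (b * F@_m - \det M) by rewrite opprB addrC subrK.
rewrite mulrBl; apply: in_idealB => //.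
have [c ->] := (AnnH _).1 bF; rewrite mulr_suml; apply: in_ideal_sum => j _.
rewrite -mulrA -(mmap1U f j) -fmD; apply/in_idealMl/(@fm_in_ideal _ _ _ j) => //.
by rewrite mnmDE mnm1E eqxx.
Qed.

(** Write [g] modulo [I] as a form of degree t in the f's. A monomial involving some [f j] with
    [j < i] lies in [I]; the other coefficients lie in (f) by [regular_coef], so expanding them
    raises the degree to t + 1. Since (f)^t has order at least t, [in_ideal_krull] concludes. *)
Lemma f_regular : regular_sequence f.
Proof.
split=> [/AnnH|i g gfi].
  by rewrite /Ann apolar1 => /eqP; rewrite (negbTE H0).
pose I := in_ideal f (fun j : 'I_n => (j < i)%N).
(* [Q t u] encodes that [u] is in I + (f)^t. *)
pose Q t u := exists2 F : {mpoly {mpoly k[n]}[n]}, F \is t.-homog & I (u - F.@[f]).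
have QD t u v : Q t u -> Q t v -> Q t (u + v).
  move=> [F Ft Fu] [G Gt Gv]; exists (F + G); first exact: dhomogD.
  by rewrite mevalD opprD addrACA; apply: in_idealD.
have QI t u : I u -> Q t u.
  by exists 0; rewrite ?dhomog0 // meval0 subr0.
have Qg t : Q t g.
  elim: t => [|t [F Ft Fg]].
    exists g%:MP; last by rewrite mevalC subrr; apply: in_ideal0.
    by rewrite -[g%:MP]mulr1 mul_mpolyC; apply: dhomogZ; apply: dhomog1.
  have Ffi : I (F.@[f] * f i).
    rewrite -[F.@[f]](subKr g) mulrBl; apply: in_idealB => //.
    exact: in_idealMr.
  rewrite -[g](subrK F.@[f]); apply: (QD); first exact: QI.
  rewrite mevalE big_seq; apply: (big_ind (Q t.+1)) => [|u v|m Fm].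
  - exact/QI/in_ideal0.
  - exact: (QD).
  rewrite -[\prod_i _]/(fm m).
  case: (boolP [exists j : 'I_n, (j < i)%N && (0 < m j)%N]) => [/existsP[j]|].
    by case/andP=> ji mj; apply/QI/in_idealMl/(@fm_in_partial _ _ j).
  rewrite negb_exists => /forallP m0.
  have [|c ->] := (AnnH F@_m).1.
    apply: (regular_coef Ft) Ffi => // j ji.
    by have := m0 j; rewrite ji -eqn0Ngt => /eqP.
  exists (\sum_l c l *: 'X_[m + U_(l)]).
    apply: rpred_sum => l _; apply: dhomogZ.
    by rewrite dhomogX /= mdegD mdeg1 addn1 (dhomog_mf Ft).
  rewrite (_ : _ * fm m = (\sum_l c l *: 'X_[m + U_(l)]).@[f]).
    by rewrite subrr; apply: in_ideal0.
  rewrite raddf_sum mulr_suml; apply: eq_bigr => l _ /=.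
  by rewrite mevalZ mevalX -[\prod_i _]/(fm _) fmD mmap1U -mulrA [f l * _]mulrC.
apply: (in_ideal_krull f_homog) => t; have [F Ft Fg] := Qg t.
exists (g - F.@[f]) => //; rewrite subKr mevalE big_seq.
apply: (big_ind (order_ge t)) => [|u v|m Fm]; first exact: order_ge0.
  exact: order_geD.
apply: (@order_geM _ _ 0 t) => //; rewrite -(dhomog_mf Ft Fm) /= mdegE.
apply: (big_ind2 (fun s => order_ge s)) => // [s1 p1 s2 p2|j _].
  exact: order_geM.
apply: order_geX => m' /(homog_order_ge (f_homog j)).
exact: leq_trans.
Qed.

End CompleteIntersection.

(** * The Jacobian determinant and its degree *)

Section Jacobian.
Variables (k : fieldType) (n : nat).
Hypothesis char0 : [pchar k] =i pred0.
Variables (f : 'I_n -> {mpoly k[n]}) (d : 'I_n -> nat).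
Hypothesis f_homog : forall i, f i \is (d i).-homog.
Hypothesis d_gt0 : forall i, (0 < d i)%N.

Definition euler_mx : 'M[{mpoly k[n]}]_n :=
  \matrix_(i, j) ((d i)%:R^-1 *: (f i)^`M(j)).

Lemma euler_mxE i : f i = \sum_j euler_mx i j * 'X_j.
Proof.
under eq_bigr do rewrite mxE -scalerAl.
rewrite -scaler_sumr (euler_homog (f_homog i)) scalerA mulVf ?scale1r //.
by rewrite natr_char0_eq0 // -lt0n.
Qed.

Lemma det_Jac : \det (Jac f) = (\prod_i (d i)%:R) *: \det euler_mx.
Proof.
have -> : Jac f = diag_mx (\row_i (d i)%:R%:MP) *m euler_mx.
  apply/matrixP => i j; rewrite mul_diag_mx !mxE mul_mpolyC scalerA divff ?scale1r //.
  by rewrite natr_char0_eq0 // -lt0n.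
rewrite det_mulmx det_diag -mul_mpolyC rmorph_prod; congr (_ * _).
by apply: eq_bigr => i _; rewrite mxE.
Qed.

Lemma apolar_Jac_neq0 H :
  (apolar (\det (Jac f)) H != 0) = (apolar (\det euler_mx) H != 0).
Proof.
rewrite det_Jac apolarZ -mul_mpolyC mulf_eq0 mpolyC_eq0 negb_or andb_idl //.
by move=> _; apply/prodf_neq0 => i _; rewrite natr_char0_eq0 // -lt0n.
Qed.

Lemma mderiv_homog (p : {mpoly k[n]}) e j :
  p \is e.-homog -> p^`M(j) \is e.-1.-homog.
Proof.
move=> /dhomogP pe; apply/dhomogP => m.
rewrite mcoeff_msupp mcoeff_mderiv -mulr_natr mulf_eq0 negb_or => /andP[pm _].
by have /pe /= <- : (m + U_(j))%MM \in msupp p; rewrite ?mcoeff_msupp // mdegD mdeg1 addn1.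
Qed.

Lemma det_Jac_homog : \det (Jac f) \is (\sum_i (d i).-1)%N.-homog.
Proof.
rewrite /determinant; apply: rpred_sum => s _; rewrite -signr_odd.
rewrite -[(-1) ^+ _]/((-1) ^+ _ : {mpoly k[n]}) rpredMsign.
apply: (big_ind2 (fun (p : {mpoly k[n]}) e => p \is e.-homog)) => [|p1 e1 p2 e2|i _].
- exact: dhomog1.
- exact: dhomogM.
by rewrite mxE mderiv_homog.
Qed.

(** A nonzero pairing at the origin forces [H] and [\det (Jac f)], both homogeneous, to share a
    monomial. *)
Lemma degree_of_Jac H e : H \is e.-homog ->
  (apolar (\det (Jac f)) H)@_0 != 0 -> e = (\sum_i (d i).-1)%N.
Proof.
move=> /dhomogP He; rewrite mcoeff0_apolar => nz.
have [m Hm Jm] : exists2 m, m \in msupp H & (\det (Jac f))@_m != 0.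
  apply/hasP; apply: contraNT nz => /hasPn J0; rewrite big_seq big1 // => m Hm.
  by have := J0 m Hm; rewrite negbK => /eqP->; rewrite mulr0.
rewrite -(He m Hm); apply: (dhomog_mf det_Jac_homog).
by rewrite mcoeff_msupp.
Qed.

End Jacobian.

Theorem proposition2p2 (k : closedFieldType) (char0 : [pchar k] =i pred0)
    (n : nat) (H : {mpoly k[n.+1]}) (H_neq0 : H != 0)
    (H_homog : exists e : nat, H \is e.-homog)
    (d : 'I_n.+1 -> nat) (d_ge2 : forall i, (2 <= d i)%N)
    (d_mono : forall i j : 'I_n.+1, (i <= j)%N -> (d i <= d j)%N)
    (Res : {mpoly k[#|coef_index d|]}) (Res_res : is_resultant Res) :
  (complete_intersection d (Ann H) <->
   exists f : 'I_n.+1 -> {mpoly k[n.+1]},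
     (forall i, form_of_degree (d i) (f i)) /\
     [/\ Res.@[coefs d f] != 0,
         forall i, apolar (f i) H = 0
       & apolar (\det (Jac f)) H != 0]) /\
  (forall f : 'I_n.+1 -> {mpoly k[n.+1]},
     (forall i, form_of_degree (d i) (f i)) ->
     [/\ Res.@[coefs d f] != 0,
         forall i, apolar (f i) H = 0
       & apolar (\det (Jac f)) H != 0] ->
     (forall g, Ann H g <-> in_ideal f predT g) /\
     (msize H).-1 = (\sum_(i < n.+1) d i - n.+1)%N).
Proof.
have [e He] := H_homog.
have d_gt0 i : (0 < d i)%N by apply: leq_trans (d_ge2 i).
have AnnE f : (forall i, form_of_degree (d i) (f i)) ->
    (forall i, apolar (f i) H = 0) -> apolar (\det (Jac f)) H != 0 ->
  forall g, Ann H g <-> in_ideal f predT g.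
  move=> f_form fH JH g; have fd i := (f_form i).2.
  apply: (Ann_eq_ideal char0 fd (euler_mxE char0 fd d_gt0) _ fH).
  by rewrite -apolar_Jac_neq0.
split; last first.
  move=> f f_form [_ fH JH]; split; first exact: AnnE.
  have fd i := (f_form i).2.
  have -> : (msize H).-1 = e.
    exact: (dhomog_uniq H_neq0 (dhomog_msize He) He).
  have sumE : (\sum_i d i = \sum_i (d i).-1 + n.+1)%N.
    rewrite -[X in (_ + X)%N]card_ord -sum1_card -big_split.
    by apply: eq_bigr => i _ /=; rewrite addn1 prednK.
  rewrite sumE addnK; apply: (degree_of_Jac fd He).
  (* The Jacobian determinant sends [H] to a constant, so being nonzero means having a nonzero
     constant term. *)
  move: JH; rewrite (det_Jac char0 f d_gt0) apolarZ mcoeffZ.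
  rewrite (apolar_det_const char0 (euler_mxE char0 fd d_gt0) fH).
  by rewrite -mul_mpolyC -mpolyCM mpolyC_eq0 mcoeffC eqxx mulr1.
split=> [[f [f_form f_reg [AnnH _]]] | [f [f_form [_ fH JH]]]]; exists f.
  have fd i := (f_form i).2; have fM := euler_mxE char0 fd d_gt0.
  split=> //; split.
  - apply/eqP => /(Res_res.2 f fd).1.
    exact: (no_projective_zero He AnnH).
  - by move=> i; apply/AnnH/in_ideal_gen.
  - by rewrite (apolar_Jac_neq0 char0 f d_gt0); apply: (det_nonAnn He fM).
have fd i := (f_form i).2; have fM := euler_mxE char0 fd d_gt0.
have AnnH := AnnE f f_form fH JH.
split=> //; first exact: (f_regular char0 H_neq0 He fd d_gt0 fM AnnH).
exact: (f_minimal He fM AnnH).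
Qed.
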